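(* Let $\varphi:\mathbb{R}^n\to\mathbb{R}$ be a $\mathcal{C}^1$ strictly convex function such that $$\lim_{\|x\|\to\infty}\frac{\varphi(x)}{\|x\|}=\infty ,$$ and assume that $\int_{\mathbb{R}^n} e^{-\varphi(x)}\,dx=1$. Let $\mu_\varphi$ be the probability measure on $\mathbb{R}^n$ given by $d\mu_\varphi(x)=e^{-\varphi(x)}dx$. Then for every function $g$ on $\mathbb{R}^n$ that is smooth enough and such that the integrals involved exist, $$\mathbf{Ent}_{\mu_\varphi}(e^g)\leq \int \Big\{x\cdot\nabla g(x)-\varphi^*(\nabla\varphi(x))+\varphi^*\big(\nabla\varphi(x)-\nabla g(x)\big)\Big\}e^{g(x)}\,d\mu_\varphi(x).$$
   Context: $\|\cdot\|$ is the Euclidean norm on $\mathbb{R}^n$, $x\cdot z$ the Euclidean scalar product, and $dx$ Lebesgue measure. The Fenchel–Legendre transform of $\varphi$ is $\varphi^*(x)=\sup_{z\in\mathbb{R}^n}\{x\cdot z-\varphi(z)\}$. For a probability measure $\mu$, $\mathbf{Ent}_{\mu}(e^g)=\int e^g\log\frac{e^g}{\int e^g d\mu}\,d\mu$. *)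

(* Defs.v *)
From HB Require Import structures.
From mathcomp Require Import all_boot all_order all_algebra.
From mathcomp Require Import all_classical all_reals all_analysis.

Set Implicit Arguments.
Unset Strict Implicit.
Unset Printing Implicit Defensive.

Import Order.TTheory GRing.Theory Num.Theory.
Import numFieldNormedType.Exports.

Local Open Scope classical_set_scope.
Local Open Scope ring_scope.

(* The product sigma-algebra on row vectors; over a realType it is the Borel
   sigma-algebra. *)
Definition measure_rV_display : measure_display -> measure_display.
Proof. exact. Qed.

Section measurable_rV.
Context {d} {T : measurableType d}.
Variable n : nat.

Let coors : 'I_n -> 'rV[T]_n -> T := fun i x => x ord0 i.

Let rV_set0 : g_sigma_preimage coors set0.
Proof. exact: sigma_algebra0. Qed.

Let rV_setC A : g_sigma_preimage coors A -> g_sigma_preimage coors (~` A).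
Proof. exact: sigma_algebraC. Qed.

Let rV_bigcup (F : _^nat) : (forall i, g_sigma_preimage coors (F i)) ->
  g_sigma_preimage coors (\bigcup_i (F i)).
Proof. exact: sigma_algebra_bigcup. Qed.

HB.instance Definition _ := @isMeasurable.Build (measure_rV_display d)
  'rV[T]_n (g_sigma_preimage coors) rV_set0 rV_setC rV_bigcup.

End measurable_rV.

Lemma measurable_coord_rV d (T : measurableType d) n (i : 'I_n) :
  measurable_fun [set: 'rV[T]_n] (fun x : 'rV[T]_n => x ord0 i).
Proof.
move=> _ Y mY; rewrite setTI; apply: sub_sigma_algebra => /=.
rewrite -bigcup_seq/=; exists i => /=; first by rewrite mem_index_enum.
by exists Y => //; rewrite setTI.
Qed.

Lemma measurable_fun_rVP d d' (S : measurableType d') (T : measurableType d) n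
    (f : S -> 'rV[T]_n) :
  (forall i, measurable_fun [set: S] (fun x => f x ord0 i)) ->
  measurable_fun [set: S] f.
Proof.
move=> mf _ A mA; rewrite setTI.
suff sub : @measurable _ 'rV[T]_n `<=` [set B | measurable (f @^-1` B)].
  exact: (sub _ mA).
apply: smallest_sub => [|B].
  split=> [|B mB|F mF]/=.
  - by rewrite preimage_set0.
  - by rewrite setTD preimage_setC; exact: measurableC.
  - by rewrite preimage_bigcup; apply: bigcup_measurable => k _; exact: mF.
rewrite -bigcup_seq/= => -[i _ [C mC <-]].
by rewrite setTI -[X in measurable X]setTI; exact: mf.
Qed.

Section lebesgue_measure_rV.
Context {R : realType}.

Definition cons_rV n (p : measurableTypeR R * 'rV[R]_n) : 'rV[R]_n.+1 :=
  row_mx (p.1%:M : 'rV[R]_1) p.2.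

Definition uncons_rV n (x : 'rV[R]_n.+1) : measurableTypeR R * 'rV[R]_n :=
  (x ord0 ord0, rsubmx (x : 'rV[R]_(1 + n))).

Lemma cons_rVK n : cancel (@cons_rV n) (@uncons_rV n).
Proof.
case=> a v; rewrite /uncons_rV /cons_rV row_mxKr; congr pair.
by rewrite mxE; case: splitP => [j _|j]//=; rewrite mxE !ord1 ?eqxx ?mulr1n.
Qed.

Lemma uncons_rVK n : cancel (@uncons_rV n) (@cons_rV n).
Proof.
move=> x; rewrite /cons_rV /uncons_rV/=.
suff -> : (x ord0 ord0)%:M = lsubmx (x : 'rV[R]_(1 + n)) by exact: (@hsubmxK R 1 1 n).
apply/rowP => i; rewrite !mxE !ord1 eqxx mulr1n.
by congr (x _ _); exact/val_inj.
Qed.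

Lemma measurable_cons_rV n : measurable_fun [set: measurableTypeR R * 'rV[R]_n] (@cons_rV n).
Proof.
apply: measurable_fun_rVP => i.
case Ei : (fintype.split (i : 'I_(1 + n))) => [j|j].
  apply: (eq_measurable_fun fst) => // x _.
  by rewrite mxE Ei mxE !ord1 eqxx mulr1n.
apply: (eq_measurable_fun (fun p : measurableTypeR R * 'rV[R]_n => p.2 ord0 j)).
  by move=> x _; rewrite mxE Ei.
by apply: (measurableT_comp (measurable_coord_rV j)).
Qed.

Lemma measurable_uncons_rV n : measurable_fun [set: 'rV[R]_n.+1] (@uncons_rV n).
Proof.
apply: measurable_fun_pair; first exact: measurable_coord_rV.
apply: measurable_fun_rVP => i.
rewrite (_ : (fun _ => _) = fun v : 'rV[R]_n.+1 => v ord0 (rshift 1 i)).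
  exact: measurable_coord_rV.
by apply/funext => x; rewrite /= mxE.
Qed.

Section lebesgue_rV_step.
Local Open Scope ereal_scope.
Variables (n : nat) (mu : {sigma_finite_measure set 'rV[R]_n -> \bar R}).

Definition lebesgue_rV_step : set 'rV[R]_n.+1 -> \bar R :=
  pushforward (lebesgue_measure \x mu) (@cons_rV n).

Let step0 : lebesgue_rV_step set0 = 0.
Proof. by rewrite /lebesgue_rV_step /pushforward preimage_set0 measure0. Qed.

Let step_ge0 A : 0 <= lebesgue_rV_step A.
Proof. by rewrite /lebesgue_rV_step /pushforward measure_ge0. Qed.

Let step_sigma_additive : semi_sigma_additive lebesgue_rV_step.
Proof.
move=> F mF tF mUF; rewrite /lebesgue_rV_step /pushforward preimage_bigcup.
have mcons (A : set 'rV[R]_n.+1) :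
    measurable A -> measurable (@cons_rV n @^-1` A).
  by move=> mA; rewrite -[X in measurable X]setTI; exact: measurable_cons_rV.
apply: measure_semi_sigma_additive.
- by move=> k; apply: mcons; exact: mF.
- apply/trivIsetP => /= i j _ _ ij; rewrite -preimage_setI.
  by move/trivIsetP : tF => /(_ _ _ _ _ ij) ->//; rewrite preimage_set0.
- by rewrite -preimage_bigcup; exact: mcons.
Qed.

HB.instance Definition _ := isMeasure.Build _ _ _ lebesgue_rV_step
  step0 step_ge0 step_sigma_additive.

Let step_sigma_finite : sigma_finite setT lebesgue_rV_step.
Proof.
have /sigma_finiteP[F [TF ndF Foo]] := sigma_finiteT (@lebesgue_measure R).
have /sigma_finiteP[G [TG ndG Goo]] := sigma_finiteT mu.
have mFG k : measurable (F k `*` G k).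
  by apply: measurableX; [have [] := Foo k|have [] := Goo k].
exists (fun k => @uncons_rV n @^-1` (F k `*` G k)).
  rewrite -preimage_bigcup (_ : \bigcup_k _ = setT) ?preimage_setT//.
  rewrite -setXTT TF TG predeqE => -[x y]; split.
    by move=> [k _ []/= ? ?]; split; exists k.
  move=> [/= [k _ Fkx] [l _ Gly]]; exists (maxn k l) => //; split.
  - by move: x Fkx; exact/subsetPset/ndF/leq_maxl.
  - by move: y Gly; exact/subsetPset/ndG/leq_maxr.
move=> k; split.
  by rewrite -[X in measurable X]setTI; exact: measurable_uncons_rV.
rewrite /lebesgue_rV_step /pushforward -comp_preimage.
rewrite (_ : _ \o _ = id) ?preimage_id; last by apply/funext => x; exact: cons_rVK.
have [? ?] := Foo k; have [? ?] := Goo k.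
by rewrite product_measure1E// lte_mul_pinfty// ge0_fin_numE.
Qed.

HB.instance Definition _ := Measure_isSigmaFinite.Build _ _ _ lebesgue_rV_step
  step_sigma_finite.

End lebesgue_rV_step.

(* R^(n+1) is identified with R * R^n via cons_rV. *)
Fixpoint lebesgue_rV n : {sigma_finite_measure set 'rV[R]_n -> \bar R} :=
  if n is m.+1 then lebesgue_rV_step (lebesgue_rV m) else \d_(0 : 'rV[R]_0).

End lebesgue_measure_rV.
Arguments lebesgue_rV : clear implicits.

Section euclidean.
Context {R : realType} {n : nat}.
Implicit Types (x y z : 'rV[R]_n) (f phi g : 'rV[R]_n -> R).

Definition dotv x y : R := \sum_(i < n) x ord0 i * y ord0 i.

(* The library norm on 'rV[R]_n is the sup norm; it is used below only through
   the topology and the notion of differentiability, which are the Euclidean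
   ones. *)
Definition enorm x : R := Num.sqrt (dotv x x).

Definition grad f x : 'rV[R]_n := \row_(i < n) 'D_(delta_mx ord0 i) f x.

Definition C1 f : Prop := (forall x, differentiable f x) /\ continuous (grad f).

Definition strictly_convex f : Prop :=
  forall x y (t : R), x != y -> 0 < t < 1 ->
    f (t *: x + (1 - t) *: y) < t * f x + (1 - t) * f y.

Definition superlinear f : Prop :=
  forall A : R, exists M : R, forall x, M <= enorm x -> A <= f x / enorm x.

Definition fenchel phi x : \bar R :=
  ereal_sup [set (dotv x z - phi z)%:E | z in [set: 'rV[R]_n]].

(* The integrand of the right-hand side, with respect to the measure of
   density exp (- phi). The values of fenchel are finite when phi is
   superlinear and continuous. *)
Definition mls_integrand phi g x : \bar R :=
  (((dotv x (grad g x))%:E - fenchel phi (grad phi x)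
    + fenchel phi (grad phi x - grad g x)%R) * (expR (g x))%:E)%E.

End euclidean.

Section entropy.
Context {d : measure_display} {T : measurableType d} {R : realType}.
Variables (mu : probability T R) (f : T -> R).

Definition ent_integrand (x : T) : R := f x * ln (f x / \int[mu]_y f y).

Definition Ent : \bar R := (\int[mu]_x (ent_integrand x)%:E)%E.

End entropy.

(* Main.v *)
Require Import Defs.
From mathcomp Require Import all_boot all_order all_algebra.
From mathcomp Require Import lra ring.
From mathcomp Require Import all_classical all_reals all_analysis.
From mathcomp Require Import measurable_realfun.

(** Put h = phi - g, so that exp g d mu = exp (- h) dx.  By convexity
phi^* (grad phi x) = x . grad phi x - phi x.  With Z = int exp (- h), and after
phi exp (- h) is subtracted from both integrands, the claim formally reads

    int (- h - ln Z) exp (- h) <= int (phi^* (grad h) - x . grad h) exp (- h).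

It is proved by transport.
Let T push the probability density exp (- h) / Z forward to exp (- phi).
Taking logarithms in the change of variables formula and using
ln det DT <= tr (DT - Id), the entropy of the first density is at most
its integral against div (T - id) - phi (T); an integration by parts
turns the divergence into (T - id) . grad h, and Young's inequality
T . grad h <= phi (T) + phi^* (grad h) eliminates T.

Only the diagonal of DT is used, so the triangular Knothe map serves as well
as an optimal one, and it can be built one coordinate at a time.  This is
done implicitly, by an induction on the dimension (box_log_sobolev): the first
coordinates of the two densities are matched by a monotone map of the line
(entropy_le_drift), and the remaining ones are handled by the induction
hypothesis on slices.

The source and the target densities are both restricted to the same box
[-L, L]^n.  There h, grad h and phi are bounded, and the map of the line fixes
the end points of [-L, L], so integrations by parts leave no boundary term,
whatever the behaviour of g at infinity.  Restricting the target only
lowers the Legendre transform and costs the term - Z ln (mu (box)), which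
vanishes as L tends to infinity.  In this limit the right-hand side is
controlled because its integrand is nonnegative (young_gap_ge). *)

Set Implicit Arguments.
Unset Strict Implicit.
Unset Printing Implicit Defensive.
Import Order.TTheory GRing.Theory Num.Theory.
Import numFieldNormedType.Exports.
Local Open Scope classical_set_scope.
Local Open Scope ring_scope.

(** * Integration over boxes *)

(** The sigma-algebra is generated by the coordinates, not by the open sets.
A continuous f is the pointwise limit of its values at the points of the grids
(k + 1)^-1 Z^n, and rounding to a grid takes countably many values, each on a
measurable cell. *)
Lemma continuous_measurable_rV (R : realType) n (f : 'rV[R]_n -> R) :
  continuous f -> measurable_fun [set: 'rV[R]_n] f.
Proof.
move=> cf.
pose q k (x : 'rV[R]_n) : 'rV[int]_n := \row_i Num.floor (k.+1%:R * x ord0 i).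
pose e k (z : 'rV[int]_n) : 'rV[R]_n := \row_i ((z ord0 i)%:~R / k.+1%:R).
apply: (@measurable_fun_cvg _ _ _ _ (fun k => f \o e k \o q k)); last first.
  move=> x _; apply: (cvg_comp (fun k => e k (q k x)) f); last exact: cf.
  apply/cvgrPdist_lt => eps eps0; near=> k.
  rewrite [X in X < _](_ : _ = mx_norm (x - e k (q k x))) //.
  rewrite mx_normrE; apply/bigmax_ltP; split => // -[i j] _ /=.
  rewrite !mxE (ord1 i).
  have /andP[] := floor_itv (k.+1%:R * x ord0 j).
  set m := Num.floor _; rewrite intrD => h1 h2.
  have k0 : (0 : R) < k.+1%:R by [].
  have -> : x ord0 j - m%:~R / k.+1%:R = (k.+1%:R * x ord0 j - m%:~R) / k.+1%:R.
    by rewrite mulrBl mulrAC divff ?mul1r// gt_eqF.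
  rewrite ger0_norm; last by rewrite divr_ge0// subr_ge0.
  rewrite ltr_pdivrMr//.
  apply: (@lt_trans _ _ 1); first by rewrite ltrBlDl.
  rewrite -ltr_pdivrMr// div1r.
  near: k; exact: near_infty_natSinv_lt (PosNum eps0).
move=> k _ Y mY; rewrite setTI.
rewrite [X in measurable X](_ : _ = \bigcup_(z : 'rV[int]_n)
   (if `[< Y (f (e k z)) >] then [set x | q k x = z] else set0)); last first.
  apply/seteqP; split=> x /=.
    by move=> Yx; exists (q k x) => //; rewrite asboolT.
  by move=> [z _]; case: asboolP => //= Yz qx; rewrite qx.
apply: countable_bigcupT_measurable; first exact: countableP.
move=> z; case: ifP => // _.
rewrite [X in measurable X](_ : _ = \bigcap_(i in [set: 'I_n])
   ((fun x : 'rV[R]_n => k.+1%:R * x ord0 i) @^-1`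
     `[(z ord0 i)%:~R, (z ord0 i + 1)%:~R[)).
  apply: fin_bigcap_measurable => // i _; rewrite -[X in measurable X]setTI.
  by apply: measurable_funM => //; exact: measurable_coord_rV.
apply/seteqP; split=> x /=.
  by move=> <- i _ /=; rewrite in_itv/= mxE floor_itv.
move=> h; apply/rowP => i; rewrite mxE; apply: floor_def.
by have := h i Logic.I; rewrite /= in_itv.
Unshelve. all: by end_near. Qed.

Definition box (R : realType) n (L : R) : set 'rV[R]_n :=
  [set x | forall i, `|x ord0 i| <= L].
Arguments box {R} n L.

Definition bounded_on (R : realType) T (A : set T) (f : T -> R) :=
  exists M : R, forall x, A x -> `|f x| <= M.

Section box_theory.
Context {R : realType}.
Implicit Types (n : nat) (L : R).

Lemma measurable_box n L : measurable (box n L).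
Proof.
rewrite [X in measurable X](_ : _ = \bigcap_(i in [set: 'I_n])
   ((fun x : 'rV[R]_n => x ord0 i) @^-1` `[- L, L])).
  apply: fin_bigcap_measurable => [|i _]; first exact: finite_finset.
  rewrite -[X in measurable X]setTI.
  exact: (measurable_coord_rV i measurableT (measurable_itv `[- L, L])).
by apply/seteqP; split=> x /= h i; have := h i; rewrite /= in_itv/= -ler_norml// => ->.
Qed.

Lemma compact_box n L : compact (box n L).
Proof.
rewrite [X in compact X](_ : _ = [set v : 'rV[R]_n | forall i, `[- L, L]%classic (v ord0 i)]).
  apply: (@rV_compact _ _ (fun=> `[- L, L]%classic)) => i; exact: segment_compact.
by apply/seteqP; split=> x /= h i; have := h i; rewrite /= in_itv/= -ler_norml.
Qed.

Lemma continuous_bounded_box n L (f : 'rV[R]_n -> R) :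
  continuous f -> bounded_on (box n L) f.
Proof.
move=> cf.
have /compact_bounded[M [_ H]] : compact (f @` box n L).
  by apply: continuous_compact (@compact_box n L); exact: continuous_subspaceT.
exists (M + 1) => x Bx; apply: (H (M + 1)); first by rewrite ltrDl.
by exists x.
Qed.

Lemma cons_rV_head n (a : R) (y : 'rV[R]_n) : cons_rV (a, y) ord0 ord0 = a.
Proof. exact: (congr1 fst (cons_rVK (a, y))). Qed.

Lemma cons_rV_tail n (a : R) (y : 'rV[R]_n) i :
  cons_rV (a, y) ord0 (lift ord0 i) = y ord0 i.
Proof.
have /(congr1 snd)/rowP/(_ i) := cons_rVK (a, y); rewrite mxE => <-.
by congr (_ ord0 _); exact/val_inj.
Qed.

Lemma cons_rVB n (a b : R) (y z : 'rV[R]_n) :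
  cons_rV (b, z) - cons_rV (a, y) = cons_rV (b - a, z - y).
Proof.
apply/rowP => i; rewrite [LHS]mxE [X in _ + X]mxE.
have [j ->|->] := unliftP ord0 i; last by rewrite !cons_rV_head.
by rewrite !cons_rV_tail !mxE.
Qed.

Lemma cons_rV_box n L (a : R) (y : 'rV[R]_n) :
  box n.+1 L (cons_rV (a, y)) <-> `|a| <= L /\ box n L y.
Proof.
split=> [h|[ha hy] i].
  by split=> [|i]; [rewrite -(cons_rV_head a y)|rewrite -(cons_rV_tail a)].
by have [j ->|->] := unliftP ord0 i; [rewrite cons_rV_tail|rewrite cons_rV_head].
Qed.

Lemma cons_rV_preimage_box n L :
  @cons_rV R n @^-1` box n.+1 L = `[- L, L] `*` box n L.
Proof.
apply/seteqP; split=> -[a y] /=.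
  by move=> /cons_rV_box[? ?]; split=> //; rewrite in_itv/= -ler_norml.
by rewrite in_itv/= -ler_norml => -[? ?]; apply/cons_rV_box.
Qed.

Lemma lebesgue_rV_box n L : 0 <= L ->
  lebesgue_rV R n (box n L) = ((2 * L) ^+ n)%:E.
Proof.
move=> L0; elim: n => [|n IH].
  rewrite /= diracE mem_set ?expr0// => -[]//.
rewrite /= /lebesgue_rV_step /pushforward cons_rV_preimage_box.
rewrite product_measure1E//=; last exact: measurable_box.
rewrite IH lebesgue_measure_itv/= lte_fin.
case: ifPn => [_|]; first by rewrite -EFinD opprK -EFinM -mulr2n -[L *+ 2]mulr_natl -exprS.
rewrite -leNgt => h; have -> : L = 0 by lra.
by rewrite mulr0 exprS mul0r mul0e.
Qed.

Lemma lebesgue_rV_box_lty n L : 0 <= L -> (lebesgue_rV R n (box n L) < +oo)%E.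
Proof. by move=> L0; rewrite lebesgue_rV_box// ltry. Qed.

Lemma integrable_bounded d (T : measurableType d) (m : {measure set T -> \bar R})
    (A : set T) (f : T -> R) : measurable A -> (m A < +oo)%E ->
  measurable_fun A f -> bounded_on A f -> m.-integrable A (EFin \o f).
Proof.
move=> mA fA mf [M HM]; apply: measurable_bounded_integrable => //.
exists M; split; first exact: num_real.
by move=> y My x /= Ax; apply: le_trans (HM _ Ax) (ltW My).
Qed.

Lemma integrable_box n L (f : 'rV[R]_n -> R) : 0 <= L ->
  measurable_fun setT f -> bounded_on (box n L) f ->
  (lebesgue_rV R n).-integrable (box n L) (EFin \o f).
Proof.
move=> L0 mf; apply: integrable_bounded; first exact: measurable_box.
  exact: lebesgue_rV_box_lty.
exact: measurable_funTS.
Qed.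

End box_theory.

Definition box_int (R : realType) n (L : R) (f : 'rV[R]_n -> R) : R :=
  \int[lebesgue_rV R n]_(x in box n L) f x.

(** This makes a function integrable over the box and, unlike integrability, is
inherited by all slices of the box rather than by almost all of them. *)
Definition tame (R : realType) n (L : R) (f : 'rV[R]_n -> R) : Prop :=
  measurable_fun [set: 'rV[R]_n] f /\ bounded_on (box n L) f.

Section box_int_theory.
Context {R : realType} {n : nat} {L : R}.
Hypothesis L0 : 0 <= L.
Implicit Types f g : 'rV[R]_n -> R.

Lemma tame_continuous f : continuous f -> tame L f.
Proof.
by move=> cf; split; [exact: continuous_measurable_rV|exact: continuous_bounded_box].
Qed.

Lemma tame_cst (r : R) : tame L (fun _ : 'rV[R]_n => r).
Proof. by split=> //; exists `|r|. Qed.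

Lemma tameD f g : tame L f -> tame L g -> tame L (fun x => f x + g x).
Proof.
move=> [mf [M HM]] [mg [N HN]]; split; first exact: measurable_funD.
exists (M + N) => x Bx; apply: le_trans (ler_normD _ _) _.
by apply: lerD; [exact: HM|exact: HN].
Qed.

Lemma tameM f g : tame L f -> tame L g -> tame L (fun x => f x * g x).
Proof.
move=> [mf [M HM]] [mg [N HN]]; split; first exact: measurable_funM.
exists (M * N) => x Bx; rewrite normrM.
by apply: ler_pM => //; [exact: HM|exact: HN].
Qed.

Lemma tameN f : tame L f -> tame L (fun x => - f x).
Proof.
move=> [mf [M HM]]; split; first exact: measurableT_comp.
by exists M => x Bx; rewrite normrN; exact: HM.
Qed.

Lemma tameB f g : tame L f -> tame L g -> tame L (fun x => f x - g x).
Proof. by move=> tf tg; apply: tameD => //; exact: tameN. Qed.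

Lemma tame_integrable f : tame L f ->
  (lebesgue_rV R n).-integrable (box n L) (EFin \o f).
Proof. by move=> [mf bf]; exact: integrable_box. Qed.

Lemma box_intD f g : tame L f -> tame L g ->
  box_int L (fun x => f x + g x) = box_int L f + box_int L g.
Proof.
move=> tf tg; apply: RintegralD; [exact: measurable_box|exact: tame_integrable..].
Qed.

Lemma box_intB f g : tame L f -> tame L g ->
  box_int L (fun x => f x - g x) = box_int L f - box_int L g.
Proof.
move=> tf tg; apply: RintegralB; [exact: measurable_box|exact: tame_integrable..].
Qed.

Lemma box_intZ f (r : R) : tame L f ->
  box_int L (fun x => r * f x) = r * box_int L f.
Proof.
move=> tf; apply: RintegralZl; [exact: measurable_box|exact: tame_integrable].
Qed.

Lemma le_box_int f g : tame L f -> tame L g ->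
  (forall x, box n L x -> f x <= g x) -> box_int L f <= box_int L g.
Proof.
move=> tf tg; apply: le_Rintegral;
  [exact: measurable_box|exact: tame_integrable..].
Qed.

Lemma eq_box_int f g : (forall x, box n L x -> f x = g x) ->
  box_int L f = box_int L g.
Proof. by move=> fg; apply: eq_Rintegral => x /set_mem; exact: fg. Qed.

Lemma box_int_norm f (M : R) : tame L f -> (forall x, box n L x -> `|f x| <= M) ->
  `|box_int L f| <= M * (2 * L) ^+ n.
Proof.
move=> tf HM.
apply: (le_trans (le_normr_Rintegral _ _)).
- exact: measurable_box.
- exact: tame_integrable.
have -> : M * (2 * L) ^+ n = box_int L (fun _ : 'rV[R]_n => M).
  rewrite /box_int Rintegral_cst; last exact: measurable_box.
  by congr (_ * _); have := lebesgue_rV_box n L0 => /= ->.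
apply: le_box_int => //; last exact: tame_cst.
split; first by apply: measurableT_comp => //; case: tf.
by exists M => x Bx; rewrite normr_id; exact: HM.
Qed.

Lemma box_int_gt0 f : 0 < L -> continuous f -> (forall x, 0 < f x) ->
  0 < box_int L f.
Proof.
move=> Lp cf f0.
(* A positive lower bound for f comes from an upper bound for its inverse. *)
have [M HM] : bounded_on (box n L) (fun x => (f x)^-1).
  apply: continuous_bounded_box => x.
  exact: (@cvgV R _ (nbhs x) _ f (f x) (lt0r_neq0 (f0 x)) (cf x)).
have M0 : 0 < M.
  have B0 : box n L (0 : 'rV[R]_n) by move=> i; rewrite mxE normr0.
  by apply: lt_le_trans (HM _ B0); rewrite normr_gt0 invr_eq0 gt_eqF.
apply: (@lt_le_trans _ _ (M^-1 * (2 * L) ^+ n)).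
  by rewrite mulr_gt0 ?invr_gt0// exprn_gt0// mulr_gt0.
have -> : M^-1 * (2 * L) ^+ n = box_int L (fun _ : 'rV[R]_n => M^-1).
  rewrite /box_int Rintegral_cst; last exact: measurable_box.
  by congr (_ * _); have := lebesgue_rV_box n L0 => /= ->.
apply: le_box_int; [exact: tame_cst|exact: tame_continuous|].
move=> x Bx; have := HM _ Bx; rewrite gtr0_norm ?invr_gt0//.
by rewrite -[in X in X -> _](invrK M) lef_pV2 ?posrE ?invr_gt0.
Qed.

End box_int_theory.

Section box_fubini.
Context {R : realType} {n : nat} {L : R}.
Hypothesis L0 : 0 <= L.
Variable f : 'rV[R]_n.+1 -> R.
Hypothesis tf : tame L f.

Lemma tame_section (a : R) : `|a| <= L -> tame L (fun y => f (cons_rV (a, y))).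
Proof.
move=> aL; split.
  apply: (measurableT_comp (proj1 tf)).
  apply: (measurableT_comp (@measurable_cons_rV R n)).
  exact: measurable_fun_pair.
case: tf => _ [M HM]; exists M => y By; apply: HM; exact/cons_rV_box.
Qed.

Let F : 'rV[R]_n.+1 -> \bar R := (EFin \o f) \_ (box n.+1 L).

Let iF : (lebesgue_rV R n.+1).-integrable setT F.
Proof.
apply/(integrable_mkcond _ (@measurable_box R n.+1 L)).
exact: tame_integrable.
Qed.

Let mF : measurable_fun [set: 'rV[R]_n.+1] F.
Proof. by case/integrableP : iF. Qed.

Let G := F \o @cons_rV R n.

Let mG : measurable_fun setT G.
Proof. by apply: measurableT_comp => //; exact: measurable_cons_rV. Qed.

Let iG : (lebesgue_measure \x lebesgue_rV R n)%E.-integrable setT G.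
Proof.
case/integrableP : iF => _; rewrite /= /lebesgue_rV_step.
rewrite ge0_integral_pushforward //; last 2 first.
- exact: measurable_cons_rV.
- exact: measurableT_comp.
by rewrite preimage_setT => h; apply/integrableP; split.
Qed.

Let innerE a : fubini_F (lebesgue_rV R n) G a =
  ((fun a => (box_int L (fun y => f (cons_rV (a, y))))%:E) \_ `[- L, L]) a.
Proof.
rewrite /fubini_F /patch mem_setE in_itv/= -ler_norml; case: ifPn => aL.
  rewrite /box_int /Rintegral fineK; last first.
    apply: integrable_fin_num; first exact: measurable_box.
    by apply: tame_integrable => //; exact: tame_section.
  rewrite [RHS]integral_mkcond; apply: eq_integral => y _.
  rewrite /G /F /= /patch; case: ifPn => [/set_mem/cons_rV_box[_ h]|].
    by rewrite mem_set.
  move=> /negP h; case: ifPn => // /set_mem By; exfalso; apply: h.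
  by rewrite inE; apply/cons_rV_box.
apply: integral0_eq => y _; rewrite /G /F /= patchE memNset//.
by move=> /cons_rV_box[h _]; rewrite h in aL.
Qed.

Lemma measurable_box_int_section :
  measurable_fun `[- L, L] (fun a => box_int L (fun y => f (cons_rV (a, y)))).
Proof.
apply/measurable_EFinP.
apply/(measurable_restrictT _ (measurable_itv `[- L, L])).
apply: (eq_measurable_fun (fubini_F (lebesgue_rV R n) G)).
  by move=> a _; exact: innerE.
exact: measurable_fubini_F iG.
Qed.

Lemma bounded_box_int_section :
  bounded_on `[- L, L] (fun a => box_int L (fun y => f (cons_rV (a, y)))).
Proof.
case: (tf) => _ [M HM]; exists (M * (2 * L) ^+ n) => a /=.
rewrite in_itv/= -ler_norml => aL.
apply: box_int_norm => //; first exact: tame_section.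
by move=> y By; apply: HM; exact/cons_rV_box.
Qed.

(** The measure in dimension n.+1 is by construction the image of a product
measure, so this is Fubini's theorem for f cut off outside the box. *)
Lemma box_intS : box_int L f =
  \int[lebesgue_measure]_(a in `[- L, L]) box_int L (fun y => f (cons_rV (a, y))).
Proof.
rewrite {1}/box_int /Rintegral; congr fine.
rewrite [RHS]integral_mkcond -(eq_integral _ _ (fun a _ => innerE a)).
rewrite integral12_prod_meas1// integral_mkcond.
rewrite /= /lebesgue_rV_step integral_pushforward//.
exact: measurable_cons_rV.
Qed.

End box_fubini.

(** * Slices and marginals *)

Section slices.
Context {R : realType} {n : nat}.

Lemma cvg_rV T (F : set_system T) {FF : Filter F} m (f : T -> 'rV[R]_m) (z : 'rV[R]_m) :
  (forall i, f t ord0 i @[t --> F] --> z ord0 i) -> f t @[t --> F] --> z.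
Proof.
move=> h; apply/cvgrPdist_lt => e e0.
have : \forall t \near F, forall i, `|z ord0 i - f t ord0 i| < e.
  by apply: filter_forall => i; have /cvgrPdist_lt/(_ _ e0) := h i.
apply: filterS => t ht.
rewrite [X in X < _](_ : _ = mx_norm (z - f t)) //.
rewrite mx_normrE; apply/bigmax_ltP; split => // -[i j] _ /=.
by rewrite !mxE (ord1 i).
Qed.

Lemma continuous_rV (T : topologicalType) m (f : T -> 'rV[R]_m) :
  (forall i, continuous (fun t => f t ord0 i)) -> continuous f.
Proof. by move=> cf x; apply: (@cvg_rV _ (nbhs x)) => i; exact: cf. Qed.

Lemma continuous_cons_rVr (a : R) : continuous (fun y : 'rV[R]_n => cons_rV (a, y)).
Proof.
apply: continuous_rV => i.
have [j ->|->] := unliftP ord0 i.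
  under eq_fun do rewrite cons_rV_tail.
  exact: coord_continuous.
under eq_fun do rewrite cons_rV_head.
exact: cst_continuous.
Qed.

Lemma continuous_cons_rVl (y : 'rV[R]_n) : continuous (fun a : R => cons_rV (a, y)).
Proof.
apply: continuous_rV => i.
have [j ->|->] := unliftP ord0 i.
  under eq_fun do rewrite cons_rV_tail.
  exact: cst_continuous.
under eq_fun do rewrite cons_rV_head.
by move=> ?; exact: cvg_id.
Qed.

Lemma continuous_slice (f : 'rV[R]_n.+1 -> R) (a : R) :
  continuous f -> continuous (fun y : 'rV[R]_n => f (cons_rV (a, y))).
Proof.
by move=> cf y; apply: continuous_comp; [exact: continuous_cons_rVr|exact: cf].
Qed.

Lemma continuous_fiber (f : 'rV[R]_n.+1 -> R) (y : 'rV[R]_n) :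
  continuous f -> continuous (fun a : R => f (cons_rV (a, y))).
Proof.
by move=> cf a; apply: continuous_comp; [exact: continuous_cons_rVl|exact: cf].
Qed.

(** A derivative along v only sees the restriction to a line; this carries
partial derivatives over to slices. *)
Lemma is_derive_line (V W : normedModType R) (f : V -> R) (g : W -> R) x v y w l :
  (forall t : R, g (t *: w + y) = f (t *: v + x)) ->
  is_derive x v f l -> is_derive y w g l.
Proof.
move=> fg [df <-].
have E : (fun h : R => h^-1 *: ((g \o shift y) (h *: w) - g y)) =
         (fun h : R => h^-1 *: ((f \o shift x) (h *: v) - f x)).
  apply/funext => h /=; rewrite fg.
  by have := fg 0; rewrite !scale0r !add0r => ->.
apply: DeriveDef; first by rewrite /derivable E.
by rewrite /derive E.
Qed.

End slices.

(** The vector of partial derivatives is given as a function of its own, so that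
the one of a slice is literally a slice of it. *)
Definition has_partials (R : realType) n (h : 'rV[R]_n -> R) (d : 'rV[R]_n -> 'rV[R]_n) :=
  forall x i, is_derive x (delta_mx ord0 i : 'rV[R]_n) h (d x ord0 i).

Section partials.
Context {R : realType} {n : nat}.
Variables (h : 'rV[R]_n.+1 -> R) (d : 'rV[R]_n.+1 -> 'rV[R]_n.+1).
Hypothesis hd : has_partials h d.

Lemma has_partials_slice (a : R) :
  has_partials (fun y : 'rV[R]_n => h (cons_rV (a, y)))
    (fun y => \row_i d (cons_rV (a, y)) ord0 (lift ord0 i)).
Proof.
move=> y i; rewrite mxE; apply: is_derive_line (hd _ _) => t.
congr h; apply/rowP => j; rewrite [RHS]mxE.
have [k ->|->] := unliftP ord0 j.
  by rewrite !cons_rV_tail !mxE !eqxx/= (inj_eq lift_inj).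
by rewrite !cons_rV_head !mxE/= mulr0 add0r.
Qed.

Lemma is_derive_fiber (a : R) (y : 'rV[R]_n) :
  is_derive a (1 : R) (fun a : R => h (cons_rV (a, y))) (d (cons_rV (a, y)) ord0 ord0).
Proof.
apply: is_derive_line (hd _ _) => t.
congr h; apply/rowP => j; rewrite [RHS]mxE.
have [k ->|->] := unliftP ord0 j.
  by rewrite !cons_rV_tail !mxE/= mulr0 add0r.
by rewrite !cons_rV_head !mxE/= mulr1n.
Qed.

End partials.

Section parameter.
Context {R : realType} {n : nat} {L : R}.
Hypothesis L0 : 0 <= L.
Implicit Types f : 'rV[R]_n.+1 -> R.

Let marginal f (a : R) := box_int L (fun y : 'rV[R]_n => f (cons_rV (a, y))).

(** A neighbourhood of a in the first variable, times the box, lies in a larger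
box; this provides the constant dominating functions for the next two
lemmas. *)
Let local_bound f (a : R) : continuous f -> exists M : R, 0 <= M /\
  forall b y, b \in `]a - 1, a + 1[ -> box n L y -> `|f (cons_rV (b, y))| <= M.
Proof.
move=> cf.
have [M HM] := @continuous_bounded_box _ _ (`|a| + 1 + L) _ cf.
exists `|M|; split=> // b y bI By.
apply: (le_trans _ (ler_norm M)); apply: HM; apply/cons_rV_box; split.
  have : `|b - a| <= 1.
    by move: bI; rewrite in_itv/= ler_distl => /andP[/ltW -> /ltW ->].
  move=> ba; rewrite -[b](subrK a) (le_trans (ler_normD _ _))//.
  by rewrite addrC -[leRHS]addrA lerD2l (le_trans ba)// lerDl.
by move=> i; rewrite (le_trans (By i))// lerDr addr_ge0.
Qed.

Lemma continuous_marginal f : continuous f -> continuous (marginal f).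
Proof.
move=> cf a.
have [M [M0 HM]] := local_bound a cf.
have aI : a \in `]a - 1, a + 1[ by rewrite in_itv/= ltrBlDr ltrDl ltr01.
apply: (@continuity_under_integral R _ _ (lebesgue_rV R n)
   (fun a y => f (cons_rV (a, y))) (box n L) _ (a - 1) (a + 1) _ _ (fun=> M)).
- exact: measurable_box.
- move=> b _; apply: tame_integrable => //; apply: tame_continuous.
  exact: continuous_slice.
- by apply: aeW => y _ b _; exact: continuous_fiber.
- by apply: tame_integrable => //; exact: tame_cst.
- by move=> b bI; apply: aeW => y By; exact: HM.
- by rewrite inE.
Qed.

Lemma is_derive_marginal f f' : continuous f -> continuous f' ->
  (forall a y, is_derive (a : R) (1 : R) (fun a : R => f (cons_rV (a, y)))
     (f' (cons_rV (a, y)))) ->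
  forall a, is_derive (a : R) (1 : R) (marginal f) (marginal f' a).
Proof.
move=> cf cf' df a.
have [M [M0 HM]] := local_bound a cf'.
have aI : a \in `]a - 1, a + 1[ by rewrite in_itv/= ltrBlDr ltrDl ltr01.
have dE b y : partial1of2 (fun a y => f (cons_rV (a, y))) b y = f' (cons_rV (b, y)).
  by rewrite partial1of2E; have [_ <-] := df b y.
have int b : (b \in `]a - 1, a + 1[) ->
    (lebesgue_rV R n).-integrable (box n L) (EFin \o (fun y => f (cons_rV (b, y)))).
  by move=> _; apply: tame_integrable => //; apply: tame_continuous; exact: continuous_slice.
have der b y : b \in `]a - 1, a + 1[ -> box n L y ->
    derivable (fun a : R => f (cons_rV (a, y))) b 1 by move=> _ _; have [] := df b y.
have iM : (lebesgue_rV R n).-integrable (box n L) (EFin \o (fun=> M)).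
  by apply: tame_integrable => //; exact: tame_cst.
have ub b y : b \in `]a - 1, a + 1[ -> box n L y ->
    `|partial1of2 (fun a y => f (cons_rV (a, y))) b y| <= M.
  by move=> bI By; rewrite dE; exact: HM.
apply: DeriveDef.
  exact: (derivable_under_integral (@measurable_box _ _ _) aI int der (fun=> M0) iM ub).
rewrite -derive1E.
rewrite (differentiation_under_integral (@measurable_box _ _ _) aI int der (fun=> M0) iM ub).
by apply: eq_box_int => y By; rewrite dE.
Qed.

End parameter.
Arguments continuous_slice {R n f} a _.
Arguments has_partials_slice {R n h d} _ a.

(** * Monotone transport on a segment *)

Section one_dim.
Context {R : realType}.
Notation leb := (@lebesgue_measure R).

Lemma continuous_integrable_itv (f : R -> R) (a b : R) :
  {within `[a, b], continuous f} -> leb.-integrable `[a, b] (EFin \o f).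
Proof. by move=> cf; apply: continuous_compact_integrable => //; exact: segment_compact. Qed.

Lemma within_continuousM (A : set R) (f g : R -> R) :
  {within A, continuous f} -> {within A, continuous g} ->
  {within A, continuous (fun x => f x * g x)}.
Proof. by move=> cf cg x; apply: continuousM; [exact: cf|exact: cg]. Qed.

Lemma is_derive_primitive (f : R -> R) (r y : R) : continuous f -> r < y ->
  is_derive y (1 : R) (fun y => \int[leb]_(t in `[r, y]) f t) (f y).
Proof.
move=> cf ry.
have yy1 : y < y + 1 by rewrite ltrDl.
have iF := continuous_integrable_itv (@continuous_subspaceT _ _ `[r, y + 1]%classic f cf).
have [dF F'] := continuous_FTC1_closed yy1 iF ry (cf y).
by apply: DeriveDef; [exact: dF|rewrite -derive1E; exact: F'].
Qed.

Lemma within_continuous_is_derive (f f' : R -> R) (a b : R) :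
  (forall x, x \in `[a, b] -> is_derive x (1 : R) f (f' x)) ->
  {within `[a, b], continuous f}.
Proof. by move=> df; apply: derivable_within_continuous => x xab; have [] := df x xab. Qed.

Lemma Rintegral_is_derive (f f' : R -> R) (a b : R) : a < b ->
  (forall x, x \in `[a, b] -> is_derive x (1 : R) f (f' x)) ->
  {within `[a, b], continuous f'} ->
  \int[leb]_(x in `[a, b]) f' x = f b - f a.
Proof.
move=> ab df cf'.
have cat x : x \in `[a, b] -> {for x, continuous f}.
  move=> /df[dfx _]; apply: differentiable_continuous; exact/derivable1_diffP.
rewrite /Rintegral (@continuous_FTC2 _ _ f)// /=.
  split.
  - by move=> x /subset_itv_oo_cc /df[].
  - by apply: cvg_at_right_filter; apply: cat; rewrite in_itv/= lexx ltW.
  - by apply: cvg_at_left_filter; apply: cat; rewrite in_itv/= lexx ltW.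
by move=> x /subset_itv_oo_cc /df[_ <-]; rewrite derive1E.
Qed.

Lemma is_derive_pos_lt (f f' : R -> R) (a b : R) : a < b ->
  (forall x, x \in `[a, b] -> is_derive x (1 : R) f (f' x)) ->
  (forall x, 0 < f' x) -> f a < f b.
Proof.
move=> ab df f'0.
have df' x : x \in `]a, b[ -> is_derive x 1 f (f' x).
  by move=> xab; apply: df; exact: subset_itv_oo_cc.
have [z _ E] := MVT ab df' (within_continuous_is_derive df).
by rewrite -subr_gt0 E mulr_gt0// subr_gt0.
Qed.

(** T is determined by the balance of mass to the left of x:
int_a^(T x) c = q int_a^x rho. *)
Lemma monotone_transport (a b : R) (rho c : R -> R) : a < b ->
  continuous rho -> (forall x, 0 < rho x) -> continuous c -> (forall x, 0 < c x) ->
  let q := (\int[leb]_(x in `[a, b]) c x) / (\int[leb]_(x in `[a, b]) rho x) in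
  exists T : R -> R, [/\ T a = a, T b = b, 0 < q &
    forall x, x \in `[a, b] -> T x \in `[a, b] /\
      is_derive x (1 : R) T (q * rho x / c (T x))].
Proof.
move=> ab crho rho0 cc c0 q.
(* The primitives start left of a - 1 and are inverted on [a - 1, b + 1], so
   that T is differentiable at the end points a and b too. *)
have ba' : b < b + 1 by rewrite ltrDl.
have aa' : a - 1 < a by rewrite gtrBl.
have aa'' : a - 1 - 1 < a - 1 by rewrite gtrBl.
pose G y := \int[leb]_(t in `[a - 1 - 1, y]) c t.
pose F y := \int[leb]_(t in `[a - 1 - 1, y]) rho t.
have dG y : a - 1 <= y -> is_derive y (1 : R) G (c y).
  by move=> ay; apply: is_derive_primitive => //; exact: lt_le_trans ay.
have dF y : a - 1 <= y -> is_derive y (1 : R) F (rho y).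
  by move=> ay; apply: is_derive_primitive => //; exact: lt_le_trans ay.
have IG : \int[leb]_(x in `[a, b]) c x = G b - G a.
  apply: Rintegral_is_derive => //; last exact: continuous_subspaceT.
  by move=> x; rewrite in_itv/= => /andP[ax _]; apply: dG; exact: le_trans (ltW aa') ax.
have IF : \int[leb]_(x in `[a, b]) rho x = F b - F a.
  apply: Rintegral_is_derive => //; last exact: continuous_subspaceT.
  by move=> x; rewrite in_itv/= => /andP[ax _]; apply: dF; exact: le_trans (ltW aa') ax.
have Glt x y : a - 1 <= x -> x < y -> G x < G y.
  move=> ax xy; apply: (@is_derive_pos_lt G c) => // z; rewrite in_itv/= => /andP[xz _].
  by apply: dG; exact: le_trans xz.
have Flt x y : a - 1 <= x -> x < y -> F x < F y.
  move=> ax xy; apply: (@is_derive_pos_lt F rho) => // z; rewrite in_itv/= => /andP[xz _].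
  by apply: dF; exact: le_trans xz.
have Fle x y : a - 1 <= x -> x <= y -> F x <= F y.
  by move=> ax; rewrite le_eqVlt => /predU1P[->//|/(Flt _ _ ax)/ltW].
have q0 : 0 < q.
  by rewrite /q IG IF divr_gt0// subr_gt0; [apply: Glt|apply: Flt] => //; exact: ltW.
pose g u := xget 0 [set y | y \in `[a - 1, b + 1] /\ G y = u].
have Gg : {in `[a - 1, b + 1], cancel G g}.
  move=> y yI; rewrite /g; case: xgetP => [z _ [zI zE]|]; last by move=> /(_ y); case.
  move: yI zI; rewrite !in_itv/= => /andP[ay _] /andP[az _].
  have [zy|yz|//] := ltgtP z y.
    by have := Glt _ _ az zy; rewrite zE ltxx.
  by have := Glt _ _ ay yz; rewrite zE ltxx.
pose u x := q * (F x - F a) + G a.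
have ua : u a = G a by rewrite /u subrr mulr0 add0r.
have ub : u b = G b.
  rewrite /u /q IG IF divfK ?subrK// gt_eqF// subr_gt0.
  by apply: Flt => //; exact: ltW.
exists (g \o u).
have aI : a \in `[a - 1, b + 1] by rewrite in_itv/= (ltW aa')/= (le_trans (ltW ab))// ltW.
have bI : b \in `[a - 1, b + 1].
  by rewrite in_itv/= (ltW ba') andbT (le_trans _ (ltW ab))// ltW.
split=> //=; [by rewrite ua Gg|by rewrite ub Gg|].
move=> x xab.
have [ax xb] : a <= x /\ x <= b by move: xab; rewrite in_itv/= => /andP[].
have [y yab Gy] : exists2 y, y \in `[a, b] & G y = u x.
  apply: IVT; first exact: ltW.
    apply: (@within_continuous_is_derive _ c) => z; rewrite in_itv/= => /andP[az _].
    by apply: dG; exact: le_trans (ltW aa') az.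
  have -> : Num.min (G a) (G b) = G a.
    by apply/min_idPl/ltW/Glt => //; exact: ltW.
  have -> : Num.max (G a) (G b) = G b.
    by apply/max_idPr/ltW/Glt => //; exact: ltW.
  rewrite -{1}ua -ub /u !lerD2r !ler_pM2l// !lerD2r; apply/andP; split.
    by apply: Fle => //; exact: ltW.
  by apply: Fle => //; exact: le_trans (ltW aa') ax.
have [ay yb] : a <= y /\ y <= b by move: yab; rewrite in_itv/= => /andP[].
have yI : y \in `]a - 1, b + 1[.
  by rewrite in_itv/= (lt_le_trans aa' ay)/= (le_lt_trans yb ba').
have Ty : g (u x) = y by rewrite -Gy Gg//; exact: subset_itv_oo_cc.
rewrite Ty; split=> //.
have dg : is_derive (u x) (1 : R) g (c y)^-1.
  rewrite -Gy; apply: (@is_derive_inverse _ G g).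
  - near=> z; apply: Gg; apply: subset_itv_oo_cc; near: z; exact: near_in_itvoo.
  - near=> z.
    have zI : z \in `]a - 1, b + 1[ by near: z; exact: near_in_itvoo.
    have [] : is_derive z (1 : R) G (c z).
      by apply: dG; move: zI; rewrite in_itv/= => /andP[/ltW].
    by move=> /derivable1_diffP/differentiable_continuous.
  - by apply: dG; exact: le_trans (ltW aa') ay.
  - by rewrite gt_eqF.
have dFx := dF x (le_trans (ltW aa') ax).
have du : is_derive x (1 : R) u (q * rho x).
  have : is_derive x (1 : R) (q \*: (F - cst (F a)) + cst (G a)) (q *: (rho x - 0) + 0).
    by apply: is_deriveD.
  by rewrite subr0 addr0.
have := is_derive1_comp dg du.
by rewrite /GRing.scale /= mulrC.
Unshelve. all: by end_near. Qed.

(** As T' = C / Z * rho / c (T) and ln T' <= T' - 1, the integrand on the left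
is at most the derivative of rho * (T - id) plus (ln Z - ln C) * rho.  The
derivative integrates to 0 because T fixes both end points. *)
Lemma entropy_le_drift (a b : R) (rho rho' c : R -> R) : a < b ->
  (forall x, is_derive x (1 : R) rho (rho' x)) -> continuous rho' ->
  (forall x, 0 < rho x) -> continuous c -> (forall x, 0 < c x) ->
  let Z := \int[leb]_(x in `[a, b]) rho x in
  let C := \int[leb]_(x in `[a, b]) c x in
  exists T : R -> R, [/\ {within `[a, b], continuous T},
    (forall x, x \in `[a, b] -> T x \in `[a, b]),
    {within `[a, b], continuous (fun x =>
       rho x * (ln (rho x) - ln (c (T x))) + (T x - x) * rho' x)} &
    \int[leb]_(x in `[a, b])
       (rho x * (ln (rho x) - ln (c (T x))) + (T x - x) * rho' x)
      <= Z * (ln Z - ln C)].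
Proof.
move=> ab drho crho' rho0 cc c0 Z C.
have crho : continuous rho.
  by move=> x; have [/derivable1_diffP/differentiable_continuous] := drho x.
have [T [Ta Tb]] := monotone_transport ab crho rho0 cc c0.
rewrite -/Z -/C; set q := C / Z => q0 dT.
have Tab x : x \in `[a, b] -> T x \in `[a, b] by move=> /dT[].
have cT : {within `[a, b], continuous T}.
  by apply: (@within_continuous_is_derive _ (fun x => q * rho x / c (T x))) => x /dT[].
have wc (f : R -> R) : continuous f -> {within `[a, b], continuous f}.
  exact: continuous_subspaceT.
have clnr : continuous (fun x => ln (rho x)).
  by move=> x; apply: continuous_comp; [exact: crho|exact: continuous_ln].
have clnc : continuous (fun x => ln (c x)).
  by move=> x; apply: continuous_comp; [exact: cc|exact: continuous_ln].
have cVT : {within `[a, b], continuous (fun x => (c (T x))^-1)}.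
  have cV : continuous (fun x => (c x)^-1).
    by move=> x; apply: continuousV; [rewrite gt_eqF|exact: cc].
  by move=> x; exact: (@continuous_comp (subspace `[a, b]) R R T (fun x => (c x)^-1) x (cT x) (cV _)).
have clncT : {within `[a, b], continuous (fun x => ln (c (T x)))}.
  by move=> x; exact: (@continuous_comp (subspace `[a, b]) R R T (fun x => ln (c x)) x (cT x) (clnc _)).
have cTx : {within `[a, b], continuous (fun x => T x - x)}.
  by apply: within_continuousB => //; apply: wc => x; exact: cvg_id.
pose D x := q * rho x / c (T x).
have cD : {within `[a, b], continuous D}.
  do 2! apply: within_continuousM => //; first exact/wc/cst_continuous.
  exact: wc.
pose P x := rho x * (T x - x).
pose P' x := rho x * (D x - 1) + (T x - x) * rho' x.
have cP' : {within `[a, b], continuous P'}.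
  apply: within_continuousD; apply: within_continuousM; [exact: wc| |by []|exact: wc].
  by apply: within_continuousB => //; exact/wc/cst_continuous.
have dP x : x \in `[a, b] -> is_derive x (1 : R) P (P' x).
  move=> /dT[_ dTx].
  have H : is_derive x (1 : R) (rho * (T - id)) (rho x *: (D x - 1) + (T x - x) *: rho' x).
    by apply: is_deriveM.
  exact: H.
have IP' : \int[leb]_(x in `[a, b]) P' x = 0.
  by rewrite (Rintegral_is_derive ab dP cP') /P Ta Tb !subrr !mulr0 subrr.
have cR : {within `[a, b], continuous (fun x =>
    rho x * (ln (rho x) - ln (c (T x))) + (T x - x) * rho' x)}.
  apply: within_continuousD; apply: within_continuousM; [exact: wc| |by []|exact: wc].
  by apply: within_continuousB => //; exact: wc.
exists T; split=> //.
have [Z0 C0] : 0 < Z /\ 0 < C.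
  have pos (f : R -> R) : continuous f -> (forall x, 0 < f x) -> 0 < \int[leb]_(x in `[a, b]) f x.
    move=> cf f0; pose p y := \int[leb]_(t in `[a - 1, y]) f t.
    have dp x : x \in `[a, b] -> is_derive x (1 : R) p (f x).
      rewrite in_itv/= => /andP[ax _]; apply: is_derive_primitive => //.
      by rewrite ltrBlDr (le_lt_trans ax)// ltrDl.
    rewrite (Rintegral_is_derive ab dp (wc _ cf)) subr_gt0.
    exact: is_derive_pos_lt dp f0.
  by split; apply: pos.
have cZ : {within `[a, b], continuous (fun x => (ln Z - ln C) * rho x)}.
  by apply: within_continuousM; [exact/wc/cst_continuous|exact: wc].
have le1 : \int[leb]_(x in `[a, b])
       (rho x * (ln (rho x) - ln (c (T x))) + (T x - x) * rho' x) <=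
   \int[leb]_(x in `[a, b]) (P' x + (ln Z - ln C) * rho x).
  apply: le_Rintegral => //.
  - exact: continuous_integrable_itv.
  - by apply: continuous_integrable_itv; exact: within_continuousD.
  move=> x xab; rewrite /P' addrAC lerD2r [_ * rho x]mulrC -mulrDr ler_pM2l//.
  have D0 : 0 < D x by rewrite /D divr_gt0// mulr_gt0.
  have := @le_ln1Dx R (D x - 1); rewrite [1 + _]addrC subrK ltrBrDr addNr => /(_ D0).
  have -> : ln (D x) = ln C - ln Z + ln (rho x) - ln (c (T x)).
    have qr0 : 0 < q * rho x by rewrite mulr_gt0.
    rewrite /D (ln_div qr0 (c0 _)) (lnM q0 (rho0 _)).
    by rewrite /q (ln_div C0 Z0).
  by lra.
apply: (le_trans le1).
rewrite RintegralD//; last 2 first.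
- exact: continuous_integrable_itv.
- exact: continuous_integrable_itv.
rewrite IP' add0r RintegralZl//; first by rewrite mulrC.
by apply: continuous_integrable_itv; exact: wc.
Qed.

End one_dim.

(** * The entropy inequality on a box *)

Definition mass (R : realType) n (L : R) (h : 'rV[R]_n -> R) : R :=
  box_int L (fun x => expR (- h x)).

Section box_inequality.
Context {R : realType}.
Notation leb := (@lebesgue_measure R).

Lemma continuous_expRN (T : topologicalType) (h : T -> R) :
  continuous h -> continuous (fun x => expR (- h x)).
Proof.
move=> ch x.
exact: (@continuous_comp _ _ _ (fun x => - h x) expR x (continuousN (ch x)) (@continuous_expR R _)).
Qed.

Lemma box_int0 (L : R) (f : 'rV[R]_0 -> R) : measurable_fun setT f ->
  box_int L f = f 0.
Proof.
move=> mf; rewrite /box_int /Rintegral.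
rewrite (_ : box 0 L = setT); last by apply/seteqP; split => // x _ [].
by rewrite /= integral_dirac ?diracT ?mul1e//; exact/measurable_EFinP.
Qed.

Let slice_arith (A K D r x y : R) : A - r * x <= K + D - r * y ->
  A <= K + (r * (x - y) + D).
Proof. by lra. Qed.

Let sum_arith (K I z x y : R) : I <= z * (x - y) -> K + I <= K - z * y + z * x.
Proof. by lra. Qed.

(** The function k stands for phi^* (d x) - x . d x, with the supremum in phi^*
restricted to the box; allowing any bounded majorant spares the measurability
of a supremum and makes the bound stable under slicing.

For the induction, let T be the monotone transport between the first marginals
rho of exp (- h) and c of exp (- phi).  For each first coordinate a, the
induction hypothesis is applied to h (a, .) and phi (T a, .), for which
k (a, .) - (T a - a) * d_0 is an admissible bound.  Integrated against
exp (- h) over the slice, the correction - (T a - a) * d_0 becomes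
(T a - a) * rho' a, and the masses of the slices are rho a and c (T a): what
remains, after integration over a, is entropy_le_drift. *)
Lemma box_log_sobolev n (L : R) (h phi k : 'rV[R]_n -> R) (d : 'rV[R]_n -> 'rV[R]_n) :
  0 < L -> continuous h -> (forall i, continuous (fun x => d x ord0 i)) ->
  has_partials h d -> continuous phi -> tame L k ->
  (forall x z, box n L x -> box n L z -> dotv (z - x) (d x) - phi z <= k x) ->
  box_int L (fun x => - h x * expR (- h x)) - mass L h * ln (mass L h) <=
  box_int L (fun x => k x * expR (- h x)) - mass L h * ln (mass L phi).
Proof.
move=> Lp; have L0 := ltW Lp.
elim: n h phi k d => [|n IH] h phi k d ch cd hd cphi tk hk.
  have ce := continuous_expRN ch.
  have mh := continuous_measurable_rV ch.
  have me := continuous_measurable_rV ce.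
  have mp := continuous_measurable_rV (continuous_expRN cphi).
  rewrite /mass !box_int0//; last 2 first.
  - by apply: measurable_funM => //; case: tk.
  - by apply: measurable_funM => //; exact: measurableT_comp.
  rewrite !expRK.
  have B0 : box 0 L (0 : 'rV[R]_0) by case.
  have := hk 0 0 B0 B0; rewrite /dotv big_ord0 sub0r => k0.
  have := expR_gt0 (- h 0); nra.
have ce := continuous_expRN ch.
pose rho := fun a : R => box_int L (fun y : 'rV[R]_n => expR (- h (cons_rV (a, y)))).
pose d0e := fun x => - d x ord0 ord0 * expR (- h x).
have cd0e : continuous d0e.
  move=> x; exact: (@continuousM _ _ (fun x => - d x ord0 ord0) (fun x => expR (- h x)) x
    (continuousN (cd ord0 x)) (ce x)).
pose rho' := fun a : R => box_int L (fun y : 'rV[R]_n => d0e (cons_rV (a, y))).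
pose c := fun a : R => box_int L (fun y : 'rV[R]_n => expR (- phi (cons_rV (a, y)))).
have drho a : is_derive a (1 : R) rho (rho' a).
  apply: (@is_derive_marginal _ _ _ L0 (fun x => expR (- h x)) d0e) => // {}a y.
  have dh := is_derive_fiber hd a y.
  rewrite /d0e mulrC.
  apply: (@is_derive1_comp _ expR (fun a => - h (cons_rV (a, y)))).
have crho' : continuous rho' by exact: continuous_marginal.
have rho0 a : 0 < rho a.
  by apply: box_int_gt0 => //; [exact: (continuous_slice a ce)|move=> y; exact: expR_gt0].
have cc : continuous c by exact: (@continuous_marginal _ _ _ L0 (fun x => expR (- phi x)) (continuous_expRN cphi)).
have c0 a : 0 < c a.
  apply: box_int_gt0 => //; last by move=> y; exact: expR_gt0.
  exact: (continuous_slice a (continuous_expRN cphi)).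
have LL : - L < L by rewrite gtrN.
have [T [cT TL cR IR]] := entropy_le_drift LL drho crho' rho0 cc c0.
have tce : tame L (fun x => expR (- h x)) by exact: tame_continuous.
have tcp : tame L (fun x => expR (- phi x)).
  by apply: tame_continuous => //; exact: continuous_expRN.
have tA : tame L (fun x => - h x * expR (- h x)).
  by apply: tameM => //; apply: tameN; exact: tame_continuous.
have tK : tame L (fun x => k x * expR (- h x)) by exact: tameM.
have td : tame L (fun x => d x ord0 ord0) by exact: tame_continuous.
have tD : tame L d0e by apply: tameM => //; exact: tameN.
rewrite -(box_intS L0 tce) -/(mass L h) -(box_intS L0 tcp) -/(mass L phi) in IR.
rewrite (box_intS L0 tA) (box_intS L0 tK).
pose Rf x := rho x * (ln (rho x) - ln (c (T x))) + (T x - x) * rho' x.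
have step a : a \in `[- L, L] ->
    box_int L (fun y => - h (cons_rV (a, y)) * expR (- h (cons_rV (a, y)))) <=
    box_int L (fun y => k (cons_rV (a, y)) * expR (- h (cons_rV (a, y)))) + Rf a.
  move=> aI.
  have aL : `|a| <= L by move: aI; rewrite in_itv/= -ler_norml.
  have TaL : `|T a| <= L by have := TL _ aI; rewrite in_itv/= -ler_norml.
  have tka : tame L (fun y => k (cons_rV (a, y)) -
      (T a - a) * d (cons_rV (a, y)) ord0 ord0).
    apply: tameB; first exact: (tame_section tk aL).
    by apply: tameM; [exact: tame_cst|exact: (tame_section td aL)].
  have cda i : continuous (fun y : 'rV[R]_n =>
      (\row_i d (cons_rV (a, y)) ord0 (lift ord0 i) : 'rV[R]_n) ord0 i).
    rewrite (_ : (fun _ => _) = (fun y => d (cons_rV (a, y)) ord0 (lift ord0 i))).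
      exact: (continuous_slice a (cd _)).
    by apply/funext => y; rewrite mxE.
  have hka y z : box n L y -> box n L z ->
      dotv (z - y) (\row_i d (cons_rV (a, y)) ord0 (lift ord0 i)) -
        phi (cons_rV (T a, z)) <=
      k (cons_rV (a, y)) - (T a - a) * d (cons_rV (a, y)) ord0 ord0.
    move=> By Bz.
    have B1 : box n.+1 L (cons_rV (a, y)) by apply/cons_rV_box.
    have B2 : box n.+1 L (cons_rV (T a, z)) by apply/cons_rV_box.
    rewrite lerBrDr; apply: le_trans (hk _ _ B1 B2).
    rewrite addrAC lerD2r cons_rVB /dotv [in leRHS]big_ord_recl addrC.
    rewrite cons_rV_head lerD2l; apply: ler_sum => i _.
    by rewrite cons_rV_tail [X in _ * X]mxE.
  have H := IH _ _ _ _ (continuous_slice a ch) cda (has_partials_slice hd a)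
    (continuous_slice (T a) cphi) tka hka.
  rewrite /mass -/(rho a) -/(c (T a)) in H.
  have E : box_int L (fun y => (k (cons_rV (a, y)) -
      (T a - a) * d (cons_rV (a, y)) ord0 ord0) * expR (- h (cons_rV (a, y)))) =
    box_int L (fun y => k (cons_rV (a, y)) * expR (- h (cons_rV (a, y)))) +
    (T a - a) * rho' a.
    rewrite -box_intZ//; last exact: (tame_section tD aL).
    rewrite -box_intD//; last 2 first.
    - exact: (tame_section tK aL).
    - by apply: tameM; [exact: tame_cst|exact: (tame_section tD aL)].
    by apply: eq_box_int => y _; rewrite /d0e; ring.
  by apply: slice_arith; rewrite -E.
have iS (f : 'rV[R]_n.+1 -> R) : tame L f -> leb.-integrable `[- L, L]
    (EFin \o (fun a => box_int L (fun y => f (cons_rV (a, y))))).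
  move=> tf; apply: integrable_bounded => //.
  - by rewrite /= lebesgue_measure_itv/= lte_fin LL -EFinB ltry.
  - exact: measurable_box_int_section.
  - exact: bounded_box_int_section.
have iR : leb.-integrable `[- L, L] (EFin \o Rf) by exact: continuous_integrable_itv.
have iKR : leb.-integrable `[- L, L] (EFin \o (fun a =>
    box_int L (fun y => k (cons_rV (a, y)) * expR (- h (cons_rV (a, y)))) + Rf a)).
  by apply: (integrableD _ (iS _ tK) iR); exact: measurable_itv.
rewrite lerBlDr; apply: le_trans.
  by apply: (le_Rintegral _ (iS _ tA) iKR step); exact: measurable_itv.
rewrite RintegralD//; last exact: (iS _ tK).
exact: sum_arith.
Qed.

End box_inequality.

(** * Densities, gradients and exhaustion by boxes *)

Section density.
Context d (T : measurableType d) {R : realType}.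
Variables (nu : {sigma_finite_measure set T -> \bar R}) (mu : probability T R).
Variable w : T -> R.
Hypothesis mw : measurable_fun [set: T] w.
Hypothesis muE : forall A, measurable A -> (mu A = \int[nu]_(x in A) (w x)%:E)%E.

Lemma density_dominates : mu `<< nu.
Proof.
apply/null_content_dominatesP => A mA A0.
apply/eqP; rewrite eq_le measure_ge0 andbT muE//.
by rewrite (null_set_integral mA)//; exact/measurable_funTS/measurable_EFinP.
Qed.

(** By uniqueness, w is the Radon-Nikodym derivative of mu. *)
Lemma integral_density (U : set T) (f : T -> \bar R) :
  measurable U -> mu.-integrable U f ->
  (\int[mu]_(x in U) f x = \int[nu]_(x in U) (f x * (w x)%:E))%E.
Proof.
move=> mU intf; have mf : measurable_fun U f by case/integrableP : intf.
rewrite -(Radon_Nikodym_change_of_variables density_dominates)//=.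
apply: ae_eq_integral => //.
- apply: emeasurable_funM => //; apply: (measurable_int nu).
  apply: (integrableS _ _ (@subsetT _ _)) => //=.
  by apply: Radon_Nikodym_integrable; exact: density_dominates.
- by apply: emeasurable_funM => //=; exact/measurable_funTS/measurable_EFinP.
- apply: ae_eqe_mul2l => /=.
  rewrite Radon_NikodymE//=; first exact: density_dominates.
  move=> dom; case: cid => /= h [h1 h2 h3].
  apply: integral_ae_eq => //=.
  + exact: integrableS h2.
  + exact/measurable_funTS/measurable_EFinP.
  + by move=> E E01 mE; rewrite -h3//= muE.
Qed.

End density.

Section gradient.
Context {R : realType} {n : nat}.
Implicit Types (f : 'rV[R]_n -> R) (x v z : 'rV[R]_n).

Lemma derive_grad f x v : differentiable f x -> 'D_v f x = dotv v (grad f x).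
Proof.
move=> df; rewrite deriveE// [in LHS](row_sum_delta v) linear_sum /dotv.
apply: eq_bigr => i _; rewrite linearZ /= /grad mxE deriveE//.
Qed.

(** By convexity the difference quotients along z - x are at most f z - f x;
the derivative is their limit from the right. *)
Lemma convex_above_tangent f x z : strictly_convex f -> differentiable f x ->
  dotv (z - x) (grad f x) <= f z - f x.
Proof.
move=> cf df; have [->|zx] := eqVneq z x.
  by rewrite !subrr /dotv big1// => i _; rewrite mxE mul0r.
rewrite -derive_grad//.
have : derivable f x (z - x) by exact: diff_derivable.
move=> dfz; rewrite /derive (cvg_at_rightE _ _ dfz).
apply: limr_le.
  by move/cvg_ex : dfz => [l hl]; apply/cvg_ex; exists l; exact: cvg_dnbhs_at_right.
near=> t.
have t0 : 0 < t by near: t; exact: nbhs_right_gt.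
have t1 : t < 1 by near: t; exact: nbhs_right_lt.
rewrite /= /GRing.scale /= mulrC ler_pdivrMr//.
have -> : t *: (z - x) + x = t *: z + (1 - t) *: x.
  by rewrite scalerBr scalerBl scale1r [RHS]addrA addrAC.
have t01 : 0 < t < 1 by rewrite t0 t1.
have := cf z x t zx t01.
set u := f _; lra.
Unshelve. all: by end_near. Qed.

Lemma dotvBl x y v : dotv (x - y) v = dotv x v - dotv y v.
Proof.
rewrite /dotv -sumrB; apply: eq_bigr => i _.
by rewrite !mxE mulrBl.
Qed.

Lemma has_partials_differentiable f : (forall x, differentiable f x) ->
  has_partials f (grad f).
Proof.
by move=> df x i; apply: DeriveDef; [exact: diff_derivable|rewrite mxE].
Qed.

Lemma has_partialsB f g (df dg : 'rV[R]_n -> 'rV[R]_n) :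
  has_partials f df -> has_partials g dg ->
  has_partials (fun x => f x - g x) (fun x => df x - dg x).
Proof.
move=> hf hg x i; rewrite !mxE.
have := is_deriveB (hf x i) (hg x i).
exact.
Qed.

End gradient.

Section exhaustion.
Context {R : realType} {n : nat}.
Variable mu : {measure set 'rV[R]_n -> \bar R}.

Lemma cvg_Rintegral_box (f : 'rV[R]_n -> R) : mu.-integrable setT (EFin \o f) ->
  \int[mu]_(x in box n k.+1%:R) f x @[k --> \oo] --> \int[mu]_x f x.
Proof.
move=> intf; have mf : measurable_fun setT (EFin \o f) by case/integrableP : intf.
apply: fine_cvg; rewrite fineK; last exact: integrable_fin_num.
under eq_fun do rewrite integral_mkcond.
apply: (@dominated_cvg _ _ _ mu _ _ _ _ (fun x => `|(f x)%:E|%E)) => //.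
- by move=> k; apply/(measurable_restrictT _ (@measurable_box R n k.+1%:R)); exact: measurable_funTS.
- move=> x _; apply: cvg_near_cst; near=> k; rewrite /patch mem_set// => i.
  apply: (@le_trans _ _ (\sum_i `|x ord0 i|)).
    by rewrite (bigD1 i)//= lerDl sumr_ge0.
  near: k; exists (Num.trunc (\sum_i `|x ord0 i|)) => //= k hk.
  apply: ltW; apply: (lt_le_trans (truncnS_gt _)).
  by rewrite ler_nat ltnS.
- exact: integrable_abse.
- move=> k x _; rewrite /patch; case: ifPn => // _.
  by rewrite abse0.
Unshelve. all: by end_near. Qed.

End exhaustion.

(** * The modified logarithmic Sobolev inequality *)

Section young_gap.
Context {R : realType} {n : nat}.
Variables phi g : 'rV[R]_n -> R.

(** Up to the factor exp g, this is the integrand of the right-hand side.  For convex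
phi it is phi^* (y) - x . y + phi x at y = grad phi x - grad g x, the defect in Young's
inequality. *)
Definition young_gap (x : 'rV[R]_n) : \bar R :=
  ((dotv x (grad g x))%:E - fenchel phi (grad phi x)
   + fenchel phi (grad phi x - grad g x)%R)%E.

Lemma dotvC (x y : 'rV[R]_n) : dotv x y = dotv y x.
Proof. by rewrite /dotv; apply: eq_bigr => i _; rewrite mulrC. Qed.

Lemma fenchel_ge (y z : 'rV[R]_n) : ((dotv y z - phi z)%:E <= fenchel phi y)%E.
Proof. by apply: ereal_sup_ubound; exists z. Qed.

Lemma fenchel_grad_le x : strictly_convex phi -> differentiable phi x ->
  (fenchel phi (grad phi x) <= (dotv x (grad phi x) - phi x)%:E)%E.
Proof.
move=> cphi dphi; apply: ge_ereal_sup => _ [z _ <-]; rewrite lee_fin.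
have := convex_above_tangent z cphi dphi; rewrite dotvBl dotvC; lra.
Qed.

(** The case z = x gives nonnegativity. *)
Lemma young_gap_ge x z : strictly_convex phi -> differentiable phi x ->
  ((dotv (z - x) (grad phi x - grad g x) - phi z + phi x)%:E <= young_gap x)%E.
Proof.
move=> cphi dphi; rewrite /young_gap.
apply: (@le_trans _ _ ((dotv x (grad g x))%:E - (dotv x (grad phi x) - phi x)%:E
   + (dotv (grad phi x - grad g x) z - phi z)%:E)%E).
  rewrite -EFinB -EFinD lee_fin [dotv (z - x) _]dotvBl.
  rewrite !(dotvC _ (grad phi x - grad g x)) !dotvBl.
  by rewrite !(dotvC _ x) !(dotvC _ z); lra.
by apply: leeD; [apply: leeB => //; exact: fenchel_grad_le|exact: fenchel_ge].
Qed.

End young_gap.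

Lemma cancel_potential (R : realType) (A I P z lz lc M : R) :
  I <= M -> A - P - z * lz <= I - P - z * lc -> A - z * lz <= M - z * lc.
Proof. by lra. Qed.

Theorem theorem2p1 (R : realType) (n : nat) (phi : 'rV[R]_n -> R)
  (phi_C1 : C1 phi)
  (phi_convex : strictly_convex phi)
  (phi_lim : superlinear phi)
  (phi_int : (\int[lebesgue_rV R n]_x (expR (- phi x))%:E = 1)%E)
  (mu : probability 'rV[R]_n R)
  (mu_def : forall A : set 'rV[R]_n, measurable A ->
    mu A = (\int[lebesgue_rV R n]_(x in A) (expR (- phi x))%:E)%E)
  (g : 'rV[R]_n -> R)
  (g_C1 : C1 g)
  (g_exp_int : mu.-integrable [set: 'rV[R]_n] (fun x => (expR (g x))%:E))
  (g_ent_int : mu.-integrable [set: 'rV[R]_n]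
    (fun x => (ent_integrand mu (fun y => expR (g y)) x)%:E))
  (g_rhs_int : mu.-integrable [set: 'rV[R]_n] (mls_integrand phi g)) :
  (Ent mu (fun x => expR (g x)) <= \int[mu]_x mls_integrand phi g x)%E.
Proof.
have [dphi cdphi] := phi_C1; have [dg cdg] := g_C1.
have cphi : continuous phi by move=> x; exact: differentiable_continuous.
have cg : continuous g by move=> x; exact: differentiable_continuous.
pose h x := phi x - g x.
pose dh x := grad phi x - grad g x.
have ch : continuous h by move=> x; apply: continuousB; [exact: cphi|exact: cg].
have cdh i : continuous (fun x => dh x ord0 i).
  rewrite (_ : (fun _ => _) = fun x => grad phi x ord0 i - grad g x ord0 i).
    have coord (f : 'rV[R]_n -> 'rV[R]_n) : continuous f -> continuous (fun x => f x ord0 i).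
      by move=> cf x; exact: (@continuous_comp _ _ _ f (fun y : 'rV[R]_n => y ord0 i) x (cf x)
        (@coord_continuous R 1 n ord0 i _)).
    by move=> x; apply: continuousB; exact: coord.
  by apply/funext => x; rewrite !mxE.
have hdh : has_partials h dh.
  by apply: has_partialsB; exact: has_partials_differentiable.
have ehE x : expR (- h x) = expR (g x) * expR (- phi x).
  by rewrite -expRD; congr expR; rewrite /h; ring.
have mw := continuous_measurable_rV (continuous_expRN cphi).
have ceg : continuous (fun x => expR (g x)).
  by move=> x; exact: (continuous_comp (cg x) (@continuous_expR R _)).
have mbox k : (mu (box n k.+1%:R) < +oo)%E.
  exact: (le_lt_trans (probability_le1 mu (@measurable_box R n k.+1%:R)) (ltry 1)).
have imu k (f : 'rV[R]_n -> R) : tame k.+1%:R f ->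
    mu.-integrable (box n k.+1%:R) (EFin \o f).
  move=> [mf bf].
  exact: (integrable_bounded (@measurable_box R n _) (mbox k) (measurable_funTS mf) bf).
have tr k (f : 'rV[R]_n -> R) : tame k.+1%:R f ->
    box_int k.+1%:R (fun x => f x * expR (- phi x)) = \int[mu]_(x in box n k.+1%:R) f x.
  move=> tf; rewrite /box_int /Rintegral; congr fine; apply/esym.
  by rewrite (integral_density mw mu_def (@measurable_box R n k.+1%:R) (imu _ _ tf)).
pose Z := \int[mu]_x expR (g x).
pose Zk k := \int[mu]_(x in box n k.+1%:R) expR (g x).
pose ck k := \int[mu]_(x in box n k.+1%:R) (1 : R).
pose Ak k := \int[mu]_(x in box n k.+1%:R) (g x * expR (g x)).
pose RM := fine (\int[mu]_x mls_integrand phi g x).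
have teg k : tame k.+1%:R (fun x => expR (g x)) by exact: tame_continuous.
have tg k : tame k.+1%:R g by exact: tame_continuous.
have tphi k : tame k.+1%:R phi by exact: tame_continuous.
have teh k : tame k.+1%:R (fun x => expR (- h x)).
  by apply: tame_continuous => //; exact: continuous_expRN.
have massh k : mass k.+1%:R h = Zk k.
  by rewrite /Zk -tr//; apply: eq_box_int => x _; rewrite ehE.
have massphi k : mass k.+1%:R phi = ck k.
  by rewrite /ck -tr; [apply: eq_box_int => x _; rewrite mul1r|exact: tame_cst].
have gap0 x : (0 <= young_gap phi g x)%E.
  apply: le_trans (young_gap_ge g x phi_convex (dphi x)).
  by rewrite subrr /dotv big1 ?add0r ?addNr// => i _; rewrite mxE mul0r.
have mgap : measurable_fun setT (young_gap phi g).
  apply: (eq_measurable_fun (fun x => mls_integrand phi g x * (expR (- g x))%:E)%E).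
    move=> x _; rewrite /mls_integrand -/(young_gap phi g x) -muleA -EFinM -expRD.
    by rewrite subrr expR0 mule1.
  apply: emeasurable_funM; first by case/integrableP : g_rhs_int.
  by apply/measurable_EFinP; apply: continuous_measurable_rV; exact: continuous_expRN.
have mlsE x : mls_integrand phi g x = (young_gap phi g x * (expR (g x))%:E)%E by [].
have RM_fin : (\int[mu]_x mls_integrand phi g x)%E = RM%:E.
  by rewrite /RM fineK//; exact: integrable_fin_num.
have mmls : measurable_fun setT (mls_integrand phi g) by case/integrableP : g_rhs_int.
have boxineq k : Ak k - Zk k * ln (Zk k) <= RM - Zk k * ln (ck k).
  set L : R := k.+1%:R.
  have Lp : 0 < L by [].
  have [N HN] : exists N : R, forall x z, box n L x -> box n L z ->
      dotv (z - x) (dh x) - phi z + phi x <= N.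
    have /choice[M HM] i := continuous_bounded_box L (cdh i).
    have [P HP] := continuous_bounded_box L cphi.
    exists ((L + L) * (\sum_i M i) + P + P) => x z Bx Bz.
    apply: lerD; last exact: le_trans (ler_norm _) (HP _ Bx).
    apply: lerD; last by apply: le_trans (ler_norm _) _; rewrite normrN; exact: HP.
    rewrite /dotv mulr_sumr; apply: ler_sum => i _.
    apply: (le_trans (ler_norm _)); rewrite normrM; apply: ler_pM => //; last exact: HM.
    by rewrite 2!mxE (le_trans (ler_normB _ _))// lerD.
  (* The gap may be unbounded, or even infinite, on the box.  Truncated at a
     bound of the numbers that it must dominate on the box, it is an admissible k
     in box_log_sobolev, up to the term phi. *)
  pose m x := fine (mine (young_gap phi g x) (`|N|)%:E).
  have mE x : (m x)%:E = mine (young_gap phi g x) (`|N|)%:E.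
    rewrite /m fineK// fin_numElt; apply/andP; split.
      by apply: (@lt_le_trans _ _ 0%E) => //; rewrite le_min gap0 lee_fin normr_ge0.
    by rewrite (@le_lt_trans _ _ (`|N|)%:E) ?ltry// ge_min lexx orbT.
  have m0 x : 0 <= m x by rewrite -lee_fin mE le_min gap0 lee_fin normr_ge0.
  have tm : tame L m.
    split.
      apply: (measurableT_comp (fine_measurable measurableT)).
      by apply: measurable_mine => //; exact: measurable_cst.
    exists `|N| => x _; rewrite ger0_norm// -lee_fin mE.
    by rewrite ge_min lexx orbT.
  have hyp x z : box n L x -> box n L z -> dotv (z - x) (dh x) - phi z <= m x - phi x.
    move=> Bx Bz; rewrite lerBrDr -lee_fin mE le_min.
    apply/andP; split; first exact: young_gap_ge.
    by rewrite lee_fin (le_trans (HN _ _ Bx Bz))// ler_norm.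
  have L0 := ltW Lp.
  have tep : tame L (fun x => expR (- phi x)) by exact/tame_continuous/continuous_expRN.
  have tpe : tame L (fun x => phi x * expR (- h x)) by exact: (tameM (tphi k) (teh k)).
  have := box_log_sobolev Lp ch cdh hdh cphi (tameB tm (tphi k)) hyp.
  rewrite massh massphi.
  have -> : box_int L (fun x => - h x * expR (- h x)) =
      Ak k - box_int L (fun x => phi x * expR (- h x)).
    rewrite /Ak -tr; last exact: tameM.
    rewrite -(box_intB L0 (tameM (tameM (tg k) (teg k)) tep) tpe).
    by apply: eq_box_int => x _; rewrite /h ehE; ring.
  have -> : box_int L (fun x => (m x - phi x) * expR (- h x)) =
      box_int L (fun x => m x * expR (g x) * expR (- phi x)) -
      box_int L (fun x => phi x * expR (- h x)).
    rewrite -(box_intB L0 (tameM (tameM tm (teg k)) tep) tpe).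
    by apply: eq_box_int => x _; rewrite ehE; ring.
  rewrite (tr k (fun x => m x * expR (g x)) (tameM tm (teg k))).
  have : \int[mu]_(x in box n L) (m x * expR (g x)) <= RM.
    rewrite -lee_fin -RM_fin /Rintegral fineK; last first.
      by apply: integrable_fin_num; [exact: measurable_box|exact: imu (tameM _ _)].
    apply: (@le_trans _ _ (\int[mu]_(x in box n L) mls_integrand phi g x)%E).
      apply: ge0_le_integral; first exact: measurable_box.
      - by move=> x _; rewrite lee_fin mulr_ge0// expR_ge0.
      - have [mm _] := tameM tm (teg k).
        by apply/measurable_EFinP; exact: measurable_funTS.
      - by apply: measurable_funTS.
      - move=> x _; rewrite mlsE EFinM lee_wpmul2r// ?lee_fin ?expR_ge0//.
        by rewrite mE ge_min lexx.
    apply: ge0_subset_integral => //.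
    - exact: measurable_box.
    - by move=> x _; rewrite mlsE mule_ge0// lee_fin expR_ge0.
  exact: cancel_potential.
have cZ : Zk k @[k --> \oo] --> Z by exact: cvg_Rintegral_box.
have Z0 : 0 < Z.
  apply: (@lt_le_trans _ _ (Zk 0)).
    by rewrite -massh; apply: box_int_gt0 => // [|x]; [exact: continuous_expRN|exact: expR_gt0].
  apply: fine_le; [|exact: integrable_fin_num|].
    by apply: integrable_fin_num; [exact: measurable_box|exact: imu].
  apply: ge0_subset_integral => //; first exact: measurable_box.
  by case/integrableP : g_exp_int.
have c1 : ck k @[k --> \oo] --> (1 : R).
  have -> : 1 = \int[mu]_x (1 : R).
    rewrite Rintegral_cst// mul1r.
    by have /(congr1 fine) := probability_setT mu.
  apply: cvg_Rintegral_box; exact: finite_measure_integrable_cst.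
have entE x : ent_integrand mu (fun y => expR (g y)) x = g x * expR (g x) - ln Z * expR (g x).
  rewrite /ent_integrand -/Z ln_div ?posrE ?expR_gt0// expRK; ring.
have iZeg : mu.-integrable setT (EFin \o (fun x => ln Z * expR (g x))).
  have := integrableZl measurableT (ln Z) g_exp_int.
  by [].
have igeg : mu.-integrable setT (EFin \o (fun x => g x * expR (g x))).
  have := integrableD measurableT g_ent_int iZeg.
  apply: eq_integrable => // x _ /=.
  by rewrite -EFinD entE subrK.
have cA : Ak k @[k --> \oo] --> \int[mu]_x (g x * expR (g x)).
  exact: cvg_Rintegral_box.
have cZln : Zk k * ln (Zk k) @[k --> \oo] --> Z * ln Z.
  by apply: cvgM => //; apply: (continuous_cvg _ (continuous_ln Z0)).
have ccln : Zk k * ln (ck k) @[k --> \oo] --> Z * ln 1.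
  by apply: cvgM => //; apply: (continuous_cvg _ (continuous_ln ltr01)).
have final : \int[mu]_x (g x * expR (g x)) - Z * ln Z <= RM - Z * ln 1.
  apply: (ler_cvg_to (cvgB cA cZln) (cvgB (cvg_cst RM) ccln)).
  by apply: nearW => k; exact: boxineq.
rewrite ln1 mulr0 subr0 in final.
rewrite RM_fin /Ent -(fineK (integrable_fin_num measurableT g_ent_int)) lee_fin.
apply: le_trans final.
rewrite -[leLHS]/(Rintegral mu setT (fun x => ent_integrand mu (fun y => expR (g y)) x)).
rewrite (eq_Rintegral _ (fun x _ => entE x)) RintegralB// RintegralZl//.
by rewrite mulrC.
Qed.
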